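(* Let $(X,\rho,\mathcal{S})$ be an unbounded complete hyperbolic space, let $\theta\in X$, let $\phi$ be an admissible function, let $s\geq1$ and $\psi_s(t)=t^{1/s}$ for $t\in(0,\infty)$, and let $\mathcal{M}$ be the set of all nonexpansive self-mappings of $X$. Let $\mathcal{P}\subset\mathcal{M}$ be the set of all $f\in\mathcal{M}$ which have a unique fixed point $x_f\in X$ and for which, for every $x\in X$, the sequence defined by $x_0=x$, $x_{n+1}=f(x_n)$ converges to $x_f$. Then $\mathcal{M}\setminus\mathcal{P}$ is $\sigma$-$\sqrt{\phi}$-porous in $(\mathcal{M},d_{\theta,\phi})$ and $\sigma$-$\psi_s$-porous in $(\mathcal{M},d_{\theta,s})$. If, moreover, $\phi$ satisfies \[ \phi^{-1}\left(\tfrac{t}{a+b}\right)\leq\phi^{-1}\left(\tfrac{t}{a}\right)\phi^{-1}\left(\tfrac{t}{b}\right) \] for all $a,b\geq1$ and $t\in(0,1)$, then $\mathcal{M}\setminus\mathcal{P}$ is $\sigma$-$\phi$-porous in $(\mathcal{M},d_{\theta,\phi})$.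
   Context: Hyperbolic spaces. A geodesic metric space is a metric space $(X,\rho)$ such that for all $x,y\in X$ there is an isometric embedding $c\colon[0,\rho(x,y)]\to X$ with $c(0)=x$, $c(\rho(x,y))=y$; the image of such a $c$ is a metric segment connecting $x$ and $y$. A hyperbolic space is a triple $(X,\rho,\mathcal{S})$ where $(X,\rho)$ is a geodesic metric space and $\mathcal{S}$ is a family of metric segments such that: (1) for each pair $x,y\in X$, $\mathcal{S}$ contains a unique metric segment connecting $x$ and $y$, denoted $[x,y]$; (2) for all $x,y\in X$ and $z,w\in[x,y]$ we have $[z,w]\subset[x,y]$; (3) $\rho((1-\lambda)x\oplus\lambda y,(1-\lambda)x\oplus\lambda z)\leq\lambda\rho(y,z)$ for all $x,y,z\in X$ and $\lambda\in[0,1]$, where $(1-\lambda)x\oplus\lambda y$ denotes the unique point of $[x,y]$ at distance $\lambda\rho(x,y)$ from $x$ and $(1-\lambda)\rho(x,y)$ from $y$. We write $\bar{B}(z,r)=\{x\in X\colon\rho(x,z)\leq r\}$. Nonexpansive mappings. A mapping $f\colon X\to X$ is nonexpansive if $\rho(f(x),f(y))\leq\rho(x,y)$ for all $x,y\in X$. Admissible functions. Let $I$ be $(0,1)$ or $(0,1]$. A function $\phi\colon I\to(0,\infty)$ is called admissible here if it is continuous, strictly increasing and satisfies: (C1) there is an $\eta_\phi\in I$ such that $\phi$ is concave on $(0,\eta_\phi)$ and $\phi(\eta_\phi)\geq\eta_\phi$; (C2) $\lim_{t\to0}\phi(t)=0$ and there is a $t\in I$ with $\phi(t)=1$; (C3)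 for every $k\in\mathbb{N}$ there is a $C_k>0$ such that $\phi^{-1}(\frac1m)\leq C_k\,\phi^{-1}(\frac1{k+m})$ for all $m\in\mathbb{N}$; (C4) $\sum_{n=1}^\infty n\,\phi^{-1}(\frac1n)$ converges. (Here $\mathbb{N}=\{1,2,\dots\}$.) Metrics. For $f,g\in\mathcal{M}$ put $d_{n,\theta}(f,g)=\sup\{\rho(f(x),g(x))\colon x\in\bar{B}(\theta,n)\}$, $d_{\theta,\phi}(f,g)=\sum_{n=1}^\infty\phi^{-1}\left(\frac1n\right)\frac{d_{n,\theta}(f,g)}{1+d_{n,\theta}(f,g)}$ and $d_{\theta,s}(f,g)=\sup_{x\in X}\frac{\rho(f(x),g(x))}{1+\rho(x,\theta)^s}$. Porosity. Let $(M,d)$ be a metric space, $A\subset M$, $x\in A$, $\eta\in(0,\infty]$ and $\varphi\colon(0,\eta)\to(0,\infty)$ increasing. Put $\gamma(x,r,A)=\sup\{s>0\colon\exists x'\in M\text{ with }B_M(x',s)\subset B_M(x,r)\setminus A\}$, where $B_M$ denotes open balls and $\sup\emptyset=-\infty$ (so $A$ is not porous at $x$ if $\gamma(x,r,A)=-\infty$ for arbitrarily small $r$). $A$ is $\varphi$-porous at $x$ if $\liminf_{r\to0}\varphi(\gamma(x,r,A))/r>0$, $\varphi$-porous if it is $\varphi$-porous at each of its points, and $\sigma$-$\varphi$-porous if it is a countable union of $\varphi$-porous sets. *)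

(* Defs.v *)
From HB Require Import structures.
From mathcomp Require Import all_boot all_order all_algebra.
From mathcomp Require Import all_classical all_reals all_analysis.
From mathcomp Require Import ring lra.

Set Implicit Arguments.
Unset Strict Implicit.
Unset Printing Implicit Defensive.

Import Order.TTheory GRing.Theory Num.Def Num.Theory.
Import numFieldNormedType.Exports.

Local Open Scope classical_set_scope.
Local Open Scope ring_scope.

Section hyperbolic_spaces.
Context {R : realType} {X : metricType R}.
Implicit Types (S : set (set X)) (A : set X) (x y z w p q : X).

Definition is_segment x y A :=
  exists c : R -> X,
    [/\ {in `[0, mdist x y] &, forall t u, mdist (c t) (c u) = `|t - u|},
        c 0 = x, c (mdist x y) = y &
        A = c @` `[0, mdist x y] ].

Definition geodesic := forall x y, exists A, is_segment x y A.

(* [segment_of S x y A] reads A = [x, y], and [comb_of S l x y p] reads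
   p = (1 - l) x (+) l y; in a hyperbolic space both are functional. *)
Definition segment_of S x y A := S A /\ is_segment x y A.

Definition comb_of S (l : R) x y p := exists A,
  [/\ segment_of S x y A, A p, mdist x p = l * mdist x y &
      mdist p y = (1 - l) * mdist x y].

Record hyperbolic S : Prop := Hyperbolic {
  hyperbolic_geodesic : geodesic;
  hyperbolic_segments : forall A, S A -> exists x y, is_segment x y A;
  hyperbolic_unique : forall x y, exists! A, segment_of S x y A;
  hyperbolic_subsegment : forall x y z w A B,
    segment_of S x y A -> A z -> A w -> segment_of S z w B -> B `<=` A;
  hyperbolic_convex : forall x y z (l : R) p q, 0 <= l <= 1 ->
    comb_of S l x y p -> comb_of S l x z q -> mdist p q <= l * mdist y z
}.

(* The library's complete spaces are pointed, whereas its metric spaces are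
   not; hence the explicit sequential form. *)
Definition complete_metric :=
  forall u : nat -> X, cauchy (u @ \oo) -> exists l : X, u @ \oo --> l.

Definition unbounded_metric := forall r : R, exists x y, r < mdist x y.

End hyperbolic_spaces.
Arguments complete_metric {R} X.
Arguments unbounded_metric {R} X.

Section admissible_functions.
Context {R : realType}.
Implicit Types (I : interval R) (phi : R -> R).

(* Inverse of phi : I -> phi(I), equal to 0 outside phi(I). *)
Definition inv_on I phi : R -> R := 'pinv_(fun=> 0) [set` I] phi.

(* Only the values of phi on I matter. *)
Record admissible I phi : Prop := Admissible {
  adm_itv : (I = `]0, 1[) \/ (I = `]0, 1]);
  adm_gt0 : forall t, t \in I -> 0 < phi t;
  adm_cont : {within [set` I], continuous phi};
  adm_incr : {in I &, {homo phi : t u / t < u}};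
  adm_concave : exists eta, [/\ eta \in I,
    convex_function (`]0, eta[ : set R^o) (fun t => - phi t) &
    eta <= phi eta];
  adm_lim0 : phi t @[t --> 0^'+] --> 0;
  adm_one : exists2 t, t \in I & phi t = 1;
  adm_shift : forall k : nat, (0 < k)%N -> exists2 C : R, 0 < C &
    forall m : nat, (0 < m)%N ->
      inv_on I phi m%:R^-1 <= C * inv_on I phi (k + m)%:R^-1;
  adm_series : cvgn [series n.+1%:R * inv_on I phi n.+1%:R^-1]_n
}.

End admissible_functions.

Section porosity.
Context {R : realType} {M : metricType R}.
Implicit Types (A : set M) (x : M) (r : R) (g : R -> R).

Definition porosity_radius x r A : \bar R :=
  ereal_sup [set s%:E | s in
    [set s : R | 0 < s /\ exists x' : M, ball x' s `<=` ball x r `\` A]].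

(* For x in A the radius is either -oo or in ]0, r], so for a gauge g given on
   some ]0, eta[ only the values on this interval influence the lower limit.
   [er_map] sends -oo to -oo: A is not porous at x if the radius is -oo for
   arbitrarily small r. *)
Definition porous_at g x A : Prop :=
  (0 < limf_einf (fun r => er_map g (porosity_radius x r A) * (r^-1)%:E)
         (0 : R)^'+)%E.

Definition porous g A := forall x, A x -> porous_at g x A.

Definition sigma_porous g A :=
  exists2 F : nat -> set M, (forall n, porous g (F n)) & A = \bigcup_n F n.

End porosity.

Section nonexpansive_maps.
Context {R : realType}.

Definition nonexpansive (X : metricType R) (f : X -> X) :=
  forall x y, mdist (f x) (f y) <= mdist x y.

Record nonexp (X : metricType R) := Nonexp {
  nonexp_fun :> X -> X;
  nonexpP : nonexpansive nonexp_fun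
}.

HB.instance Definition _ X := gen_eqMixin (nonexp X).
HB.instance Definition _ X := gen_choiceMixin (nonexp X).

Context {X : metricType R}.
Implicit Types (f g h : nonexp X) (theta x : X) (n : nat).

Definition converging_iterates : set (nonexp X) := [set f |
  exists xf, [/\ f xf = xf, forall y, f y = y -> y = xf &
    forall x, iter n f x @[n --> \oo] --> xf]].

Definition dist_n theta n f g : R :=
  sup [set mdist (f x) (g x) | x in [set x | mdist theta x <= n%:R]].

Definition dist_phi theta I phi f g : R :=
  limn [series inv_on I phi n.+1%:R^-1 *
    (dist_n theta n.+1 f g / (1 + dist_n theta n.+1 f g))]_n.

Definition dist_s theta (s : R) f g : R :=
  sup [set mdist (f x) (g x) / (1 + mdist x theta `^ s) | x in [set: X]].

Lemma nonexp_ext f g : (forall x, f x = g x) -> f = g.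
Proof.
case: f g => f hf [g hg] /= /funext fg; subst g.
by rewrite (Prop_irrelevance hf hg).
Qed.

Lemma nonexp_dist_le theta f g x :
  mdist (f x) (g x) <= mdist (f theta) (g theta) + 2 * mdist x theta.
Proof.
have h1 := metric_triangle (f x) (f theta) (g x).
have h2 := metric_triangle (f theta) (g theta) (g x).
have h3 := nonexpP f x theta; have h4 := nonexpP g theta x.
rewrite (metric_sym theta x) in h4.
lra.
Qed.

Lemma has_sup_dist_n theta n f g :
  has_sup [set mdist (f x) (g x) | x in [set x | mdist theta x <= n%:R]].
Proof.
split; first by exists (mdist (f theta) (g theta)), theta; rewrite //= mdistxx.
exists (mdist (f theta) (g theta) + 2 * n%:R) => _ [x /= xn <-].
have := nonexp_dist_le theta f g x.
rewrite (metric_sym x theta); lra.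
Qed.

Lemma dist_n_ub theta n f g x :
  mdist theta x <= n%:R -> mdist (f x) (g x) <= dist_n theta n f g.
Proof.
by move=> xn; apply: ub_le_sup; [exact: (has_sup_dist_n _ _ _ _).2 | exists x].
Qed.

Lemma dist_n_le theta n f g (b : R) :
  (forall x, mdist theta x <= n%:R -> mdist (f x) (g x) <= b) ->
  dist_n theta n f g <= b.
Proof.
move=> hb; apply: ge_sup; first exact: (has_sup_dist_n _ _ _ _).1.
by move=> _ [x /= xn <-]; exact: hb.
Qed.

Lemma dist_n_ge0 theta n f g : 0 <= dist_n theta n f g.
Proof.
by apply: le_trans (dist_n_ub (x := theta) _ _ _); rewrite ?mdist_ge0 ?mdistxx.
Qed.

Lemma dist_n_xx theta n f : dist_n theta n f f = 0.
Proof.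
apply/le_anti; rewrite dist_n_ge0 andbT.
by apply: dist_n_le => x _; rewrite mdistxx.
Qed.

Lemma dist_n_sym theta n f g : dist_n theta n f g = dist_n theta n g f.
Proof.
by congr sup; apply: eq_imagel => x _; rewrite metric_sym.
Qed.

Lemma dist_n_triangle theta n g f h :
  dist_n theta n f h <= dist_n theta n f g + dist_n theta n g h.
Proof.
apply: dist_n_le => x xn; apply: le_trans (metric_triangle _ (g x) _) _.
by apply: lerD; exact: dist_n_ub.
Qed.

Lemma frac_le1 (a : R) : 0 <= a -> 0 <= a / (1 + a) <= 1.
Proof.
move=> a0; apply/andP; split; first by apply: divr_ge0; lra.
by rewrite ler_pdivrMr; lra.
Qed.

Lemma frac_triangle (a b c : R) : 0 <= a -> 0 <= b -> 0 <= c -> a <= b + c ->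
  a / (1 + a) <= b / (1 + b) + c / (1 + c).
Proof.
move=> a0 b0 c0 abc.
have hE (t : R) : 0 <= t -> t / (1 + t) = 1 - (1 + t)^-1.
  by move=> t0; field; apply/negP => /eqP; lra.
have mono : a / (1 + a) <= (b + c) / (1 + (b + c)).
  by rewrite !hE; [|lra..]; rewrite lerD2l lerN2 lef_pV2 ?posrE; lra.
apply: le_trans mono _; rewrite mulrDl.
by apply: lerD; rewrite ler_wpM2l// lef_pV2 ?posrE; lra.
Qed.

Lemma inv_onP (I : interval R) (phi : R -> R) n : admissible I phi ->
  0 < inv_on I phi n.+1%:R^-1.
Proof.
move=> adm; set v : R := n.+1%:R^-1.
have v0 : 0 < v by rewrite invr_gt0.
have v1 : v <= 1 by rewrite invf_le1 ?ler1n.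
have I01 t : t \in I -> 0 < t <= 1.
  by case: (adm_itv adm) => ->; rewrite in_itv/= => /andP[-> h] //; exact: ltW.
have [t1 It1 pt1] := adm_one adm.
have /andP[t10 _] := I01 _ It1.
have [e [e0 et pe]] : exists e, [/\ 0 < e, e <= t1 & phi e < v].
  have := adm_lim0 adm; move/cvgrPdist_lt => /(_ _ v0) H.
  near (0 : R)^'+ => e; exists e; split; near: e.
  - exact: nbhs_right_gt.
  - exact: nbhs_right_le.
  - by apply: filterS H => t; rewrite sub0r normrN; apply: le_lt_trans; rewrite ler_norm.
have sub : [set` `[e, t1]] `<=` [set` I].
  move=> t /=; rewrite in_itv/= => /andP[et' tt1].
  have t0 : 0 < t by exact: lt_le_trans et'.
  move: It1; case: (adm_itv adm) => ->; rewrite !in_itv/= t0 => /andP[_].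
  - exact: le_lt_trans.
  - exact: le_trans.
have cont := continuous_subspaceW sub (adm_cont adm).
have [] := @IVT _ phi e t1 v et cont.
  by rewrite pt1 ge_min le_max v1 (ltW pe) orbT.
move=> c ce pc.
have vim : v \in phi @` [set` I] by rewrite inE; exists c => //; exact: sub.
have : inv_on I phi @` (phi @` [set` I]) `<=` [set` I].
  by apply: surjpinv_image_sub; exact: image_subset.
move=> /(_ (inv_on I phi v)) /= h.
have /I01 /andP[] // : inv_on I phi v \in I.
by apply: h; exists v => //; rewrite inE in vim.
Unshelve. all: by end_near.
Qed.

Lemma is_cvg_dist_phi theta (I : interval R) (phi : R -> R) f g :
  admissible I phi ->
  cvgn [series inv_on I phi n.+1%:R^-1 *
    (dist_n theta n.+1 f g / (1 + dist_n theta n.+1 f g))]_n.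
Proof.
move=> adm; apply: series_le_cvg (adm_series adm) => n.
- apply: mulr_ge0; first exact/ltW/inv_onP.
  by have /andP[] := frac_le1 (dist_n_ge0 theta n.+1 f g).
- by apply: mulr_ge0 => //; exact/ltW/inv_onP.
- rewrite [leRHS]mulrC ler_wpM2l//; first exact/ltW/inv_onP.
  have /andP[_ h] := frac_le1 (dist_n_ge0 theta n.+1 f g).
  by apply: le_trans h _; rewrite ler1n.
Qed.

Lemma dist_phi_xx theta (I : interval R) (phi : R -> R) f :
  dist_phi theta I phi f f = 0.
Proof.
rewrite /dist_phi; under eq_fun do rewrite dist_n_xx mul0r mulr0.
rewrite (_ : series _ = cst 0); first exact: lim_cst.
by apply/funext => n; rewrite /series/= big1.
Qed.

Lemma dist_phi_sym theta (I : interval R) (phi : R -> R) f g :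
  dist_phi theta I phi f g = dist_phi theta I phi g f.
Proof.
by rewrite /dist_phi; under eq_fun do rewrite dist_n_sym.
Qed.

Lemma dist_phi_triangle theta (I : interval R) (phi : R -> R) g f h :
  admissible I phi ->
  dist_phi theta I phi f h <= dist_phi theta I phi f g + dist_phi theta I phi g h.
Proof.
move=> adm; rewrite /dist_phi -limD; [|exact: is_cvg_dist_phi..].
apply: ler_lim; first exact: is_cvg_dist_phi.
  by apply: is_cvgD; exact: is_cvg_dist_phi.
apply: nearW => n; rewrite /series/= fctE/= -big_split/=; apply: ler_sum => i _.
rewrite -mulrDr ler_wpM2l//; first exact/ltW/inv_onP.
by apply: frac_triangle; rewrite ?dist_n_ge0 ?dist_n_triangle.
Qed.

Lemma dist_phi_eq0 theta (I : interval R) (phi : R -> R) f g :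
  admissible I phi -> dist_phi theta I phi f g = 0 -> f = g.
Proof.
move=> adm d0; apply: nonexp_ext => x; apply: mdist_positivity.
have [n xn] : exists n : nat, mdist theta x <= n.+1%:R.
  exists (Num.bound (mdist theta x)); apply: le_trans (ltW (archi_boundP _)) _.
    exact: mdist_ge0.
  by rewrite ler_nat.
set u := fun n : nat => inv_on I phi n.+1%:R^-1 *
    (dist_n theta n.+1 f g / (1 + dist_n theta n.+1 f g)).
have u0 k : 0 <= u k.
  apply: mulr_ge0; first exact/ltW/inv_onP.
  by have /andP[] := frac_le1 (dist_n_ge0 theta k.+1 f g).
have un : u n <= 0.
  rewrite -d0 /dist_phi; apply: le_trans (_ : series u n.+1 <= _).
    rewrite /series/= big_nat_recr//= lerDr; exact: sumr_ge0.
  apply: nondecreasing_cvgn_le; last exact: is_cvg_dist_phi.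
  by apply: nondecreasing_series => k _.
have : dist_n theta n.+1 f g <= 0.
  rewrite leNgt; apply/negP => dn; move: un; rewrite leNgt => /negP; apply.
  by rewrite mulr_gt0 ?inv_onP// divr_gt0//; lra.
move=> dn; apply/le_anti; rewrite mdist_ge0 andbT.
by apply: le_trans dn; exact: dist_n_ub.
Qed.

Lemma has_sup_dist_s theta (s : R) f g : 1 <= s ->
  has_sup [set mdist (f x) (g x) / (1 + mdist x theta `^ s) | x in [set: X]].
Proof.
move=> s1; split; first by eexists; exists theta.
exists (mdist (f theta) (g theta) + 2) => _ [x _ <-].
have d0 := mdist_ge0 x theta; have D0 := mdist_ge0 (f theta) (g theta).
have p0 : 0 <= mdist x theta `^ s by exact: powR_ge0.
rewrite ler_pdivrMr; last lra.
apply: le_trans (nonexp_dist_le theta f g x) _.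
have : mdist x theta <= 1 + mdist x theta `^ s.
  have [d1|d1] := leP (mdist x theta) 1; first lra.
  have : mdist x theta `^ 1 <= mdist x theta `^ s by rewrite ler_powR// ltW.
  by rewrite powRr1//; lra.
nra.
Qed.

Lemma dist_s_ub theta (s : R) f g x : 1 <= s ->
  mdist (f x) (g x) / (1 + mdist x theta `^ s) <= dist_s theta s f g.
Proof.
move=> s1; apply: ub_le_sup; last by exists x.
exact: (has_sup_dist_s theta f g s1).2.
Qed.

Lemma dist_s_xx theta (s : R) f : 1 <= s -> dist_s theta s f f = 0.
Proof.
move=> s1; rewrite /dist_s.
under [X in sup X]eq_imagel do rewrite mdistxx mul0r.
rewrite (_ : [set _ | _ in _] = [set 0]) ?sup1//.
by apply/seteqP; split=> [_ [x _ <-]//|_ ->]; exists theta.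
Qed.

Lemma dist_s_sym theta (s : R) f g : dist_s theta s f g = dist_s theta s g f.
Proof. by congr sup; apply: eq_imagel => x _; rewrite metric_sym. Qed.

Lemma dist_s_triangle theta (s : R) g f h : 1 <= s ->
  dist_s theta s f h <= dist_s theta s f g + dist_s theta s g h.
Proof.
move=> s1; apply: ge_sup; first exact: (has_sup_dist_s theta f h s1).1.
move=> _ [x _ <-].
have p0 : 0 <= mdist x theta `^ s by exact: powR_ge0.
apply: le_trans (lerD (dist_s_ub theta f g x s1) (dist_s_ub theta g h x s1)).
rewrite -mulrDl ler_wpM2r ?metric_triangle// invr_ge0; lra.
Qed.

Lemma dist_s_eq0 theta (s : R) f g : 1 <= s -> dist_s theta s f g = 0 -> f = g.
Proof.
move=> s1 d0; apply: nonexp_ext => x; apply: mdist_positivity.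
have := dist_s_ub theta f g x s1; rewrite d0.
have p0 : 0 <= mdist x theta `^ s by exact: powR_ge0.
rewrite ler_pdivrMr; last lra.
by rewrite mul0r => h; apply/le_anti; rewrite h mdist_ge0.
Qed.

End nonexpansive_maps.

(* The two metric spaces on the nonexpansive self-maps of X; the hypotheses
   under which the distances are metrics are parameters of the types. *)
Definition nonexp_phi (R : realType) (X : metricType R) (theta : X)
  (I : interval R) (phi : R -> R) of admissible I phi : Type := nonexp X.

Definition nonexp_s (R : realType) (X : metricType R) (theta : X)
  (s : R) of 1 <= s : Type := nonexp X.

Section nonexp_metrics.
Context (R : realType) (X : metricType R) (theta : X).

Section phi.
Context (I : interval R) (phi : R -> R) (adm : admissible I phi).
HB.instance Definition _ := Choice.copy (nonexp_phi theta adm) (nonexp X).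
HB.instance Definition _ := isMetric.Build R (nonexp_phi theta adm)
  (fun f => dist_phi_xx theta I phi f)
  (fun f g => dist_phi_eq0 adm (f := f) (g := g))
  (fun f g => dist_phi_sym theta I phi f g)
  (fun g f h => dist_phi_triangle theta g f h adm).
End phi.

Section s.
Context (s : R) (s1 : 1 <= s).
HB.instance Definition _ := Choice.copy (nonexp_s theta s1) (nonexp X).
HB.instance Definition _ := isMetric.Build R (nonexp_s theta s1)
  (fun f => dist_s_xx theta f s1)
  (fun f g => dist_s_eq0 s1 (f := f) (g := g))
  (fun f g => dist_s_sym theta s f g)
  (fun g f h => dist_s_triangle theta g f h s1).
End s.

End nonexp_metrics.

(* Main.v *)
(* A nonexpansive map f converges to a unique fixed point from everywhere as
   soon as (a) f maps some ball B(theta, n) into itself, and (b) on every ball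
   B(theta, n), f contracts uniformly those pairs of points which are at
   distance at least 1/n.  It suffices that the failure of (a), and of (b) for
   each n, is porous.  Damp f to f_e = (1 - e) f (+) e theta, which is at
   distance O(e) from f.
   For (a), f_e moves points of a ball of radius N ~ 1/e inwards with a margin
   of 1, so every g within 1 of f_e on B(theta, N) preserves this ball; this
   holds on a metric ball of radius about phi^-1(1/N), resp. N^-s, around f_e.
   For (b), n is fixed and f_e is (1 - e)-Lipschitz, so a metric ball of radius
   proportional to e around f_e does.
   The radius N ~ 1/e matters only in (a), where the error allowed is constant
   rather than of order e: hence one gets phi-porosity for every admissible phi,
   and a fortiori sqrt(phi)-porosity. *)
Require Import Defs.
From mathcomp Require Import all_boot all_order all_algebra.
From mathcomp Require Import all_classical all_reals all_analysis.
From mathcomp Require Import ring lra.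

Set Implicit Arguments.
Unset Strict Implicit.
Unset Printing Implicit Defensive.

Import Order.TTheory GRing.Theory Num.Def Num.Theory.
Import numFieldNormedType.Exports.

Local Open Scope classical_set_scope.
Local Open Scope ring_scope.

(** * A criterion for porosity at a point *)

Lemma porous_atI (R : realType) (M : metricType R) (g : R -> R) (x : M)
    (A : set M) (delta c : R) :
  A x -> 0 < delta -> 0 < c ->
  {in `]0, delta] &, {homo g : t u / t <= u}} ->
  (\forall r \near 0^'+, exists t x',
    [/\ 0 < t, ball x' t `<=` ball x r `\` A & c * r <= g t]) ->
  porous_at g x A.
Proof.
move=> Ax delta0 c0 g_mono hole; rewrite /porous_at limf_einfE.
apply: (@lt_le_trans _ _ c%:E); first by rewrite lte_fin.
set G := fun r : R => _; set hole_at := fun r : R => _ in hole.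
set V := [set r | hole_at r /\ 0 < r <= delta].
apply: (@le_trans _ _ (ereal_inf (G @` V))); last first.
  apply: ereal_sup_ubound; exists V => //.
  near=> r; split; first by near: r.
  by apply/andP; split; near: r; [exact: nbhs_right_gt|exact: nbhs_right_le].
apply/ereal_infP => _ [r [[t [x' [t0 sub cgt]]] /andP[r0 rdelta]] <-].
have t_le : (t%:E <= porosity_radius x r A)%E.
  by apply: ereal_sup_ubound; exists t => //; split=> //; exists x'.
(* The centre of a hole is within [r] of [x], so a hole of radius above [r] would contain [x], which
   lies in [A]. Hence [g] is compared only inside []0, delta]]. *)
have le_r : (porosity_radius x r A <= r%:E)%E.
  apply: ge_ereal_sup => _ [u [u0 [y usub]] <-]; rewrite lee_fin leNgt.
  apply/negP => ru; have [xy _] := usub _ (ballxx y u0).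
  have [] // := usub x.
  by apply: ball_sym; exact: le_ball (ltW ru) _ xy.
rewrite /G; case: (porosity_radius x r A) t_le le_r => [v| |] //=.
rewrite !lee_fin => tv vr; rewrite ler_pdivlMr//; apply: le_trans cgt _.
by apply: g_mono; rewrite ?in_itv//=; lra.
Unshelve. all: by end_near. Qed.

(** * Damping towards a base point *)

Section damping.
Context {R : realType} {X : metricType R}.

(** [h x] stands for the point of the segment from [f x] to [theta] at ratio [e]; beyond
    [damped_exists], damping enters only through these estimates. *)
Record damped (theta : X) (f : nonexp X) (e : R) (h : nonexp X) : Prop := {
  damped_center : forall x, mdist theta (h x) = (1 - e) * mdist theta (f x);
  damped_dist : forall x, mdist (f x) (h x) = e * mdist theta (f x);
  damped_lip : forall x y, mdist (h x) (h y) <= (1 - e) * mdist x y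
}.

Context {S : set (set X)} (hS : hyperbolic S).

Lemma comb_of_exists (l : R) (x y : X) : 0 <= l <= 1 ->
  exists p, comb_of S l x y p.
Proof.
move=> /andP[l0 l1]; have [A [[SA Aseg] _]] := hyperbolic_unique hS x y.
have [c [c_isom c0 c1 Ac]] := Aseg.
have d0 := mdist_ge0 x y.
have ld0 : 0 <= l * mdist x y by rewrite mulr_ge0.
have ld1 : l * mdist x y <= mdist x y by rewrite ler_piMl.
exists (c (l * mdist x y)), A; split=> //.
- by rewrite Ac; exists (l * mdist x y) => //=; rewrite in_itv/= ld0.
- rewrite -[X in mdist X _]c0 c_isom ?in_itv/= ?lexx ?ld0//.
  by rewrite sub0r normrN ger0_norm.
- rewrite -[X in mdist _ X]c1 c_isom ?in_itv/= ?lexx ?ld0 ?d0//.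
  by rewrite distrC ger0_norm; lra.
Qed.

(** Taken from [theta] with parameter [1 - e], all combinations issue from one point, so
    [hyperbolic_convex] supplies the Lipschitz constant. *)
Lemma damped_exists (theta : X) (f : nonexp X) (e : R) : 0 < e < 1 ->
  exists h, damped theta f e h.
Proof.
move=> /andP[e0 e1]; have le01 : 0 <= 1 - e <= 1 by lra.
have [h hP] := choice (fun x => comb_of_exists theta (f x) le01).
have h_lip x y : mdist (h x) (h y) <= (1 - e) * mdist x y.
  apply: le_trans (hyperbolic_convex hS le01 (hP x) (hP y)) _.
  by rewrite ler_wpM2l//; [lra | exact: nonexpP].
have h_nonexp : nonexpansive h.
  move=> x y; apply: le_trans (h_lip x y) _.
  by have := mdist_ge0 x y; nra.
exists (Nonexp h_nonexp); split=> // x /=.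
- by have [A []] := hP x.
- by have [A [_ _ _]] := hP x; rewrite metric_sym subKr.
Qed.

End damping.

(** * Convergence of iterates to a unique fixed point *)

Section convergence.
Context {R : realType} {X : metricType R}.
Implicit Types (theta x y : X) (g : nonexp X).

Definition ball_invariant theta : set (nonexp X) :=
  [set g | exists n : nat, forall x,
     mdist theta x <= n.+1%:R -> mdist theta (g x) <= n.+1%:R].

(* Rakotch contractivity on all bounded sets, sampled along one parameter
   which controls both the radius and the scale. *)
Definition scale_contractive theta n : set (nonexp X) :=
  [set g | exists2 q : R, 0 <= q < 1 & forall x y,
     mdist theta x <= n.+1%:R -> mdist theta y <= n.+1%:R ->
     n.+1%:R^-1 <= mdist x y -> mdist (g x) (g y) <= q * mdist x y].

Lemma iter_nonexp g k x y : mdist (iter k g x) (iter k g y) <= mdist x y.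
Proof.
by elim: k => [|k IH]//=; apply: le_trans (nonexpP g _ _) IH.
Qed.

(** While two bounded orbits stay at least [e] apart, every step shrinks their distance by one
    factor [q < 1]. The number of steps is uniform in the starting points. *)
Lemma iter_contract theta g (r e : R) :
  (forall n, scale_contractive theta n g) -> 0 < e ->
  exists k, forall x y, (forall i, mdist theta (iter i g x) <= r) ->
    (forall i, mdist theta (iter i g y) <= r) ->
    mdist (iter k g x) (iter k g y) < e.
Proof.
move=> gC e0.
have [n [rn en]] : exists n : nat, r <= n.+1%:R /\ n.+1%:R^-1 < e.
  pose n := Num.bound (Num.max `|r| e^-1).
  have : Num.max `|r| e^-1 < n.+1%:R.
    apply: lt_trans (archi_boundP _) _; last by rewrite ltr_nat.
    by rewrite le_max normr_ge0.
  rewrite gt_max => /andP[rn en]; exists n; split.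
    by apply: le_trans (ler_norm _) (ltW rn).
  by rewrite -[ltRHS]invrK ltf_pV2 ?posrE// invr_gt0.
have [q /andP[q0 q1] gq] := gC n.
have [k qk] : exists k, q ^+ k * (2 * n.+1%:R) < e.
  have /cvgrPdist_lt : (fun k => q ^+ k * (2 * n.+1%:R)) @ \oo --> (0 : R).
    rewrite -[0](mul0r (2 * n.+1%:R)); apply: cvgMl.
    by apply: cvg_expr; rewrite ger0_norm.
  move=> /(_ _ e0)[k _ /(_ k (leqnn k))]; rewrite sub0r normrN => h.
  by exists k; apply: le_lt_trans (ler_norm _) h.
exists k => x y xr yr; rewrite ltNge; apply/negP => ek.
(* Distances along orbits never increase, so a gap of [e] at step [k] was there at all earlier
   steps. *)
have big i : (i <= k)%N -> e <= mdist (iter i g x) (iter i g y).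
  move=> ik; apply: le_trans ek _; rewrite -(subnK ik) !iterD.
  exact: iter_nonexp.
suff /(_ k (leqnn k)) h : forall i, (i <= k)%N ->
    mdist (iter i g x) (iter i g y) <= q ^+ i * mdist x y.
  move: qk; rewrite ltNge => /negP; apply; apply: le_trans (le_trans ek h) _.
  rewrite ler_wpM2l ?exprn_ge0//.
  have := metric_triangle x theta y; rewrite (metric_sym x theta).
  by have /= := xr 0%N; have /= := yr 0%N; move: rn; clear; lra.
elim=> [_|i IH ik]; first by rewrite expr0 mul1r.
rewrite exprS -mulrA; apply: le_trans (ler_wpM2l q0 (IH (ltnW ik))).
by apply: gq; [exact: le_trans (xr i) rn|exact: le_trans (yr i) rn|];
  apply: le_trans (ltW en) (big i (ltnW ik)).
Qed.

Lemma bounded_orbit_cvg theta g (r : R) x : complete_metric X ->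
  (forall n, scale_contractive theta n g) ->
  (forall i, mdist theta (iter i g x) <= r) ->
  exists2 l, g l = l & iter n g x @[n --> \oo] --> l.
Proof.
move=> X_complete gC xr.
have /X_complete[l xl] : cauchy ((fun n => iter n g x) @ \oo).
  apply: cauchy_exP => e e0; have [k gk] := iter_contract r gC e0.
  exists (iter k g x); exists k => // m /= km.
  (* The orbit is compared with its own tail: the iterate of order [m] is the [k]-th iterate of a
     later point of the orbit. *)
  rewrite ballEmdist/= -(subnKC km) iterD; apply: gk => // i.
  by rewrite -iterD.
exists l => //; apply/esym/mdist_positivity/le_anti; rewrite mdist_ge0 andbT.
apply/ler_addgt0Pl => e e0; rewrite addr0.
have e20 : 0 < e / 2 by rewrite divr_gt0.
have [k _ xk] := metricType_numDomainType.cvgr_dist_lt xl e20.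
have /= xk0 := xk k (leqnn k); have /= xk1 := xk k.+1 (leqnSn k).
have := metric_triangle l (g (iter k g x)) (g l).
have := nonexpP g (iter k g x) l; rewrite (metric_sym _ l).
by rewrite [leRHS]splitr; lra.
Qed.

(** Invariance bounds the orbit of [theta], which yields a fixed point [l]. Any other orbit stays
    within its initial distance of [l], so it is bounded and can be compared with the constant orbit
    of [l]. *)
Lemma converging_iteratesI theta g : complete_metric X ->
  ball_invariant theta g -> (forall n, scale_contractive theta n g) ->
  converging_iterates g.
Proof.
move=> X_complete [n gn] gC.
have theta_n i : mdist theta (iter i g theta) <= n.+1%:R.
  by elim: i => [|i IH]/=; [rewrite mdistxx|exact: gn].
have [l gl _] := bounded_orbit_cvg X_complete gC theta_n.
have iter_fix i y : g y = y -> iter i g y = y by move=> gy; elim: i => //= i ->.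
exists l; split=> [//|y gy|x].
  apply/eqP; rewrite -[_ == _]negbK -mdist_gt0; apply/negP => yl0.
  have [k gk] := iter_contract (Num.max (mdist theta y) (mdist theta l)) gC yl0.
  suff : false by [].
  have := gk y l; rewrite !iter_fix// ltxx; apply=> i;
    by rewrite iter_fix// le_max lexx ?orbT.
apply/metricType_numDomainType.cvgrPdist_lt => e e0.
have [k gk] := iter_contract (mdist theta l + mdist l x) gC e0.
exists k => // m /= km; rewrite -(subnKC km) iterD -[l](iter_fix k)//.
apply: gk => i; first by rewrite iter_fix// lerDl mdist_ge0.
rewrite -iterD (le_trans (metric_triangle _ l _))// lerD2l.
by rewrite -{1}(iter_fix (i + (m - k))%N l gl) iter_nonexp.
Qed.

End convergence.

(** * Porosity for an abstract metric on the maps *)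

Section sigma_porosity.
Context {R : realType} {X : metricType R} {S : set (set X)}.
Context (hS : hyperbolic S) (theta : X).
(* [M] is a copy of [nonexp X], via [j] and [k], that carries the metric. *)
Context {M : metricType R} {j : M -> nonexp X} {k : nonexp X -> M}.
Context (kK : cancel k j) {g : R -> R} {w : nat -> R} {delta : R}.
Hypothesis damped_near : forall f, exists2 C : R, 0 < C &
  forall (e : R) h, 0 < e -> damped theta (j f) e h -> mdist f (k h) <= C * e.
Hypothesis w_gt0 : forall n, 0 < w n.
Hypothesis near_ball : forall n f h (e : R) x, 0 < e <= 1 -> mdist f h < w n * e ->
  mdist theta x <= n.+1%:R -> mdist (j f x) (j h x) <= e.
Hypothesis delta_gt0 : 0 < delta.
Hypothesis gauge_mono : {in `]0, delta] &, {homo g : t u / t <= u}}.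
(** Holes have two kinds of radius: proportional to [e], measured by [gauge_scale], or [w n] with
    [n] of order 1/[e], measured by [gauge_weight]. *)
Hypothesis gauge_scale : forall c : R, 0 < c <= 1 -> exists2 c' : R, 0 < c' &
  \forall t \near 0^'+, c' * t <= g (c * t).
Hypothesis gauge_weight : exists2 c : R, 0 < c &
  \forall n \near \oo, c / n.+1%:R <= g (w n).

(** Split [r] as [C * e + e]: damping moves [f] by at most [C * e], leaving room [e] for a hole
    around the damped map. *)
Lemma porous_dampedI (A good : set (nonexp X)) :
  (forall f, exists2 c : R, 0 < c & \forall e \near 0^'+, forall h,
    damped theta (j f) e h -> exists t, [/\ 0 < t <= e, c * e <= g t &
      forall f', mdist (k h) f' < t -> good (j f')]) ->
  porous g (j @^-1` (A `\` good)).
Proof.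
move=> hole f Af; have [c c0 [d /= d0 hole_f]] := hole f.
have [C C0 f_near] := damped_near f.
apply: (@porous_atI _ _ g f _ delta (c / (C + 1))) => //.
  by rewrite divr_gt0//; lra.
near=> r; have r0 : 0 < r by near: r; exact: nbhs_right_gt.
have rd : r < d by near: r; exact: nbhs_right_lt.
have r1 : r < 1 by near: r; exact: nbhs_right_lt.
have C1 : 0 < C + 1 by lra.
pose e := r / (C + 1).
have er : r = C * e + e by rewrite /e; field; lra.
have e0 : 0 < e by rewrite divr_gt0.
have Ce0 : 0 < C * e by rewrite mulr_gt0.
have [h fh] : exists h, damped theta (j f) e h.
  by apply: damped_exists hS _ _ _ _; lra.
have [|t [/andP[t0 te] cet tgood]] := hole_f e _ e0 h fh.
  by rewrite /= sub0r normrN gtr0_norm//; lra.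
exists t, (k h); split=> //; last by rewrite mulrAC -mulrA.
rewrite !ballEmdist => f' /= hf'; split; last by move=> [_]; apply; exact: tgood.
apply: le_lt_trans (metric_triangle _ (k h) _) _.
rewrite er; apply: ler_ltD; first exact: f_near.
exact: lt_le_trans te.
Unshelve. all: by end_near. Qed.

Lemma porous_not_ball_invariant A :
  porous g (j @^-1` (A `\` ball_invariant theta)).
Proof.
apply: porous_dampedI => f; set K := mdist theta (j f theta).
have K0 : 0 <= K by exact: mdist_ge0.
have [c c0 [N _ cN]] := gauge_weight.
have [c1 c10 lin1] : exists2 c' : R, 0 < c' &
    \forall t \near 0^'+, c' * t <= g (1 * t).
  by apply: gauge_scale; lra.
(* One term for each possible hole radius, [w n] or [e]. *)
exists (Num.min (c / (K + 2)) c1).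
  by rewrite lt_min c10 andbT divr_gt0//; lra.
near=> e => h fh.
have e0 : 0 < e by near: e; exact: nbhs_right_gt.
have e1 : e < 1 by near: e; exact: nbhs_right_lt.
have eN : e < N.+1%:R^-1.
  by near: e; apply: nbhs_right_lt; rewrite invr_gt0.
(* The lower bound on [n.+1] gives the margin: (1 - e)(K + n.+1) <= n.+1 - 1. The upper bound keeps
   1/n.+1 at least e/(K + 2), for use with [gauge_weight]. *)
have [n [Nn n_le en]] : exists n : nat, [/\ (N <= n)%N,
    n.+1%:R <= (K + 2) / e & K + 1 <= n.+1%:R * e].
  have Ke0 : 0 <= (K + 1) / e by rewrite divr_ge0//; lra.
  have /andP[nK Kn] := truncn_itv Ke0.
  exists (truncn ((K + 1) / e)); split.
  - rewrite truncn_ge_nat// ler_pdivlMr//.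
    have : N.+1%:R * e < 1 by rewrite -ltr_pdivlMl ?mulr1.
    by rewrite -natr1; nra.
  - have -> : (K + 2) / e = (K + 1) / e + e^-1 by field; rewrite gt_eqF.
    by rewrite -natr1; apply: lerD => //; rewrite invf_ge1// ltW.
  - by rewrite -ler_pdivrMr// ltW.
exists (Num.min (w n) e); split.
- by rewrite lt_min w_gt0 e0 ge_min lexx orbT.
- have le1 : Num.min (c / (K + 2)) c1 * e <= c1 * e.
    by rewrite ler_pM2r// ge_min lexx orbT.
  have le2 : Num.min (c / (K + 2)) c1 * e <= c / (K + 2) * e.
    by rewrite ler_pM2r// ge_min lexx.
  have [_|_] := leP (w n) e.
    apply: le_trans le2 _; apply: le_trans (cN n Nn).
    rewrite -mulrA ler_pM2l// -[_ * e]invrK invfM invrK.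
    by rewrite lef_pV2// posrE// divr_gt0//; lra.
  apply: le_trans le1 _; rewrite -[in leRHS](mul1r e).
  by near: e.
- move=> f'; rewrite lt_min => /andP[hf' _]; exists n => x xn.
  have : mdist (j (k h) x) (j f' x) <= 1.
    by apply: near_ball xn; rewrite ?ltr01 ?lexx ?mulr1.
  have fx_le : mdist theta (j f x) <= K + n.+1%:R.
    apply: le_trans (metric_triangle _ (j f theta) _) _; rewrite lerD2l.
    exact: le_trans (nonexpP (j f) theta x) xn.
  have := metric_triangle theta (h x) (j f' x).
  have le1e : 0 <= 1 - e by lra.
  have := ler_wpM2l le1e fx_le; rewrite kK (damped_center fh x).
  by have := mulr_ge0 K0 (ltW e0); lra.
Unshelve. all: by end_near. Qed.

Lemma porous_not_scale_contractive A n :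
  porous g (j @^-1` (A `\` scale_contractive theta n)).
Proof.
apply: porous_dampedI => f.
have [v vE /andP[v0 v1]] : exists2 v : R, v = n.+1%:R^-1 & 0 < v <= 1.
  by exists n.+1%:R^-1; rewrite // invr_gt0 ltr0Sn invf_le1 ?ler1n.
(* Two errors of size [v / 4 * e] cost at most half of the contraction gain, which is at least
   [e * v]. The minimum with 1 ensures [c <= 1]. *)
pose c := Num.min (w n) 1 * (v / 4).
have c01 : 0 < c <= 1.
  apply/andP; split; first by rewrite mulr_gt0 ?lt_min ?w_gt0//; lra.
  apply: mulr_ile1.
  - by rewrite le_min (ltW (w_gt0 n)) ler01.
  - by lra.
  - by rewrite ge_min lexx orbT.
  - by lra.
have /andP[c0 c1] := c01.
have [c' c'0 lin] := gauge_scale c01.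
exists c' => //; near=> e => h fh.
have e0 : 0 < e by near: e; exact: nbhs_right_gt.
have e1 : e < 1 by near: e; exact: nbhs_right_lt.
exists (c * e); split.
- by rewrite mulr_gt0// ler_piMl// ltW.
- by near: e.
- move=> f' hf'; pose u := v / 4 * e.
  have u0 : 0 < u by rewrite mulr_gt0//; lra.
  have u1 : u <= 1 by rewrite /u; nra.
  have close x : mdist theta x <= n.+1%:R -> mdist (h x) (j f' x) <= u.
    rewrite -[h]kK; apply: near_ball; rewrite ?u0//.
    apply: lt_le_trans hf' _; rewrite /c /u -mulrA ler_wpM2r ?(ltW u0)//.
    by rewrite ge_min lexx.
  exists (1 - e / 2); first lra.
  move=> x y /close hx /close hy; rewrite -vE => xy.
  have := damped_lip fh x y.
  have := metric_triangle (j f' x) (h x) (j f' y).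
  have := metric_triangle (h x) (h y) (j f' y).
  have := ler_wpM2l (ltW e0) xy.
  rewrite (metric_sym _ (h x)); rewrite /u in hx hy.
  lra.
Unshelve. all: by end_near. Qed.

Lemma sigma_porous_nonconverging : complete_metric X ->
  sigma_porous g (j @^-1` (~` converging_iterates)).
Proof.
move=> X_complete; set P := converging_iterates.
(* Each piece is cut down to the complement of [P], since the union must equal that complement and
   not just cover it. *)
exists (fun i => j @^-1` (~` P `\`
    if i is n.+1 then scale_contractive theta n else ball_invariant theta)).
  case=> [|n]; first exact: porous_not_ball_invariant.
  exact: porous_not_scale_contractive.
apply/seteqP; split=> f /=; last by move=> [i _ []].
move=> Pf; apply: contrapT => notF; apply: (Pf).
apply: (@converging_iteratesI _ _ theta) => // [|n]; apply: contrapT => ngood.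
  by apply: notF; exists 0%N.
by apply: notF; exists n.+1.
Qed.

End sigma_porosity.

(** * Admissible functions near 0 *)

Section admissible_gauge.
Context {R : realType} {I : interval R} {phi : R -> R}.
Context (adm : admissible I phi).

Lemma admissible_itv t : t \in I -> 0 < t <= 1.
Proof.
by case: (adm_itv adm) => ->; rewrite in_itv/= => /andP[-> h] //; exact: ltW.
Qed.

Lemma admissible_itvS t u : 0 < t <= u -> u \in I -> t \in I.
Proof.
move=> /andP[t0 tu]; case: (adm_itv adm) => ->; rewrite !in_itv/= t0 => /andP[_].
- exact: le_lt_trans.
- exact: le_trans.
Qed.

Lemma admissible_mono : {in I &, {homo phi : t u / t <= u}}.
Proof.
move=> t u It Iu; rewrite le_eqVlt => /predU1P[-> //|/(adm_incr adm It Iu)].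
exact: ltW.
Qed.

(* [inv_on] is [0] off the range of [phi], hence its positivity at
   [n.+1%:R^-1] puts this point in the range. *)
Lemma inv_onK n (u := inv_on I phi n.+1%:R^-1) :
  u \in I /\ phi u = n.+1%:R^-1.
Proof.
have vim : (phi @` [set` I]) n.+1%:R^-1.
  apply: contrapT => vNim; have := inv_onP n adm.
  rewrite /inv_on /= /pinv_ [X in 0 < X](_ : _ = 0) ?ltxx//.
  rewrite splitV /= oinv_surj.
  by case: pselect.
split; last by rewrite /u /inv_on pinvK// inE.
have sub : inv_on I phi @` (phi @` [set` I]) `<=` [set` I].
  by apply: surjpinv_image_sub; exact: image_subset.
by apply: sub; exists n.+1%:R^-1.
Qed.

(** Concavity and positivity make phi(t)/t nonincreasing. As 0 is outside the interval of concavity,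
    it is replaced by a point [v > 0] whose cost [v * phi u] is at most an arbitrary [e]. *)
Lemma admissible_star : exists2 eta, eta \in I &
  forall t u : R, 0 < t < u -> u < eta -> t * phi u <= u * phi t.
Proof.
have [eta [Ieta conc _]] := adm_concave adm; exists eta => // t u /andP[t0 tu] ue.
apply/ler_addgt0Pr => e e0.
have pu : 0 < phi u.
  apply: (adm_gt0 adm); apply: admissible_itvS Ieta; lra.
have [v /andP[v0 vt] vu] : exists2 v : R, 0 < v < t & v * phi u <= e.
  exists (Num.min (t / 2) (e / phi u)).
    rewrite lt_min !divr_gt0//= gt_min; apply/orP; left; lra.
  by rewrite -ler_pdivlMr// ge_min lexx orbT.
pose l := (t - v) / (u - v).
have l01 : 0 <= l <= 1.
  by rewrite divr_ge0 ?ler_pdivrMr/=; lra.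
have [p pE] : exists p : {i01 R}, p%:num = l.
  by exists (Itv01 (andP l01).1 (andP l01).2).
have pv : 0 < phi v.
  apply: (adm_gt0 adm); apply: admissible_itvS Ieta; lra.
have pt : 0 < phi t.
  apply: (adm_gt0 adm); apply: admissible_itvS Ieta; lra.
have := conc p u v; rewrite !inE/= !in_itv/= !convRE pE.
have -> : @conv R (convex_lmodType R^o) p u v = t.
  transitivity (p%:num * u + (1 - p%:num) * v); first by [].
  by rewrite pE /l; field; lra.
rewrite /unstable.onem.
have lu : l * (u - v) = t - v by rewrite /l divfK//; lra.
have uv0 : 0 <= u - v by lra.
have ue0 : 0 < u < eta by lra.
have ve0 : 0 < v < eta by lra.
move=> /(_ ue0 ve0)/(ler_wpM2l uv0).
have : 0 <= (1 - l) * (u - v) * phi v by rewrite !mulr_ge0//; lra.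
have : l * (u - v) * phi u = (t - v) * phi u by rewrite lu.
have := mulr_gt0 v0 pt; lra.
Qed.

End admissible_gauge.

(** * Estimates for the series metric *)

Section phi_metric.
Context {R : realType} {X : metricType R} (theta : X).
Context {I : interval R} {phi : R -> R} (adm : admissible I phi).
Implicit Types f h : nonexp X.

Let inv n : R := inv_on I phi n.+1%:R^-1.

(** A single term of the series bounds D/(1 + D) by e/2, and [e <= 1] then forces D <= e; hence the
    factor 1/2 in the weight. *)
Lemma dist_phi_near_ball n f h (e : R) x : 0 < e <= 1 ->
  dist_phi theta I phi f h < inv n / 2 * e -> mdist theta x <= n.+1%:R ->
  mdist (f x) (h x) <= e.
Proof.
move=> /andP[e0 e1] fh xn; apply: le_trans (dist_n_ub _ _ xn) _.
set D := dist_n theta n.+1 f h; have D0 : 0 <= D by exact: dist_n_ge0.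
have inv0 : 0 < inv n by exact: inv_onP.
pose u i := inv i * (dist_n theta i.+1 f h / (1 + dist_n theta i.+1 f h)).
have u0 i : 0 <= u i.
  apply: mulr_ge0; first exact/ltW/inv_onP.
  by have /andP[] := frac_le1 (dist_n_ge0 theta i.+1 f h).
have : u n <= dist_phi theta I phi f h.
  apply: (@le_trans _ _ (series u n.+1)).
    by rewrite /series/= big_nat_recr//= lerDr; exact: sumr_ge0.
  apply: nondecreasing_cvgn_le; last exact: is_cvg_dist_phi.
  by apply: nondecreasing_series => i _.
move=> /le_lt_trans/(_ fh); rewrite /u -/D -mulrA ltr_pM2l//.
rewrite ltr_pdivrMr; last lra.
nra.
Qed.

(** On the ball of radius [i.+1] damping moves points by at most [(K + 1) * e * i.+1%:R], and (C4)
    makes these bounds summable. *)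
Lemma dist_phi_damped f : exists2 C : R, 0 < C &
  forall (e : R) h, 0 < e -> damped theta f e h ->
    dist_phi theta I phi f h <= C * e.
Proof.
set K := mdist theta (f theta); have K0 : 0 <= K by exact: mdist_ge0.
pose v (n : nat) := n.+1%:R * inv n; pose L := limn (series v).
have v0 n : 0 <= v n by rewrite mulr_ge0//; exact/ltW/inv_onP.
have vL n : series v n <= L.
  apply: nondecreasing_cvgn_le; last exact: (adm_series adm).
  by apply: nondecreasing_series => i _.
have L0 : 0 <= L by have := vL 0%N; rewrite /series/= big_geq.
(* The final 1 makes the constant positive, [L] being known only to be nonnegative. *)
exists ((K + 1) * L + 1) => [|e h e0 fh]; first by nra.
apply: (@le_trans _ _ ((K + 1) * e * L)); last by lra.
apply: limr_le; first exact: is_cvg_dist_phi.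
apply: nearW => n; have Ke0 : 0 <= (K + 1) * e by rewrite mulr_ge0//; lra.
apply: le_trans (ler_wpM2l Ke0 (vL n)).
rewrite /series/= mulr_sumr; apply: ler_sum => i _.
rewrite /v [leRHS]mulrA [leRHS]mulrC ler_wpM2l//; first exact/ltW/inv_onP.
set D := dist_n theta i.+1 f h; have D0 : 0 <= D by exact: dist_n_ge0.
have De : D <= (K + 1) * e * i.+1%:R.
  apply: dist_n_le => x xi; rewrite (damped_dist fh) mulrAC [leRHS]mulrC ler_wpM2l//.
    exact: ltW.
  have := metric_triangle theta (f theta) (f x); rewrite -/K.
  have := nonexpP f theta x.
  have i1 : 1 <= i.+1%:R :> R by rewrite ler1n.
  have := ler_wpM2l K0 i1; lra.
by apply: le_trans De; rewrite ler_pdivrMr ?ler_peMr//; lra.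
Qed.

End phi_metric.

(** * Estimates for the weighted supremum metric *)

Section s_metric.
Context {R : realType} {X : metricType R} (theta : X) {s : R} (s1 : 1 <= s).
Implicit Types f h : nonexp X.

Lemma le1DpowR (a : R) : 0 <= a -> a <= 1 + a `^ s.
Proof.
move=> a0; have p0 := powR_ge0 a s.
by have [a1|/ltW a1] := leP a 1; [|have := le1r_powR a1 s1]; lra.
Qed.

Lemma dist_s_near_ball n f h (e : R) x : 0 < e <= 1 ->
  dist_s theta s f h < (1 + n.+1%:R `^ s)^-1 * e -> mdist theta x <= n.+1%:R ->
  mdist (f x) (h x) <= e.
Proof.
move=> /andP[e0 _] fh xn; have := le_lt_trans (dist_s_ub theta f h x s1) fh.
have p0 := powR_ge0 (mdist x theta) s.
have pn : mdist x theta `^ s <= n.+1%:R `^ s.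
  rewrite metric_sym in xn.
  apply: ge0_ler_powR; rewrite ?nnegrE ?mdist_ge0 ?ler0n//.
  exact: le_trans s1.
rewrite ltr_pdivrMr; last lra.
move=> /ltW/le_trans; apply; rewrite mulrAC ler_piMl ?(ltW e0)//.
by rewrite ler_pdivrMl; lra.
Qed.

(** The displacement grows at most linearly in the distance d to [theta], and 1 + d^s dominates d
    because [1 <= s]. *)
Lemma dist_s_damped f : exists2 C : R, 0 < C &
  forall (e : R) h, 0 < e -> damped theta f e h -> dist_s theta s f h <= C * e.
Proof.
set K := mdist theta (f theta); have K0 : 0 <= K by exact: mdist_ge0.
exists (K + 1) => [|e h e0 fh]; first lra.
apply: ge_sup; first exact: (has_sup_dist_s theta f h s1).1.
move=> _ [x _ <-]; have p0 := powR_ge0 (mdist x theta) s.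
rewrite ler_pdivrMr; last lra.
rewrite (damped_dist fh) mulrC mulrAC ler_wpM2r ?(ltW e0)//.
have := metric_triangle theta (f theta) (f x); rewrite -/K.
have := nonexpP f theta x; rewrite (metric_sym _ x).
have := le1DpowR (mdist_ge0 x theta).
nra.
Qed.

End s_metric.

(** * The two metrics as instances *)

Section sigma_porous_metrics.
Context {R : realType} {X : metricType R} {S : set (set X)}.
Context (hS : hyperbolic S) (X_complete : complete_metric X) (theta : X).

(** A general gauge [g] covers both [phi] and its square root; the latter dominates [phi] only where
    [phi] is at most 1. *)
Lemma sigma_porous_phi {I : interval R} {phi : R -> R}
    (adm : admissible I phi) (g : R -> R) :
  {in I &, {homo g : t u / t <= u}} ->
  (forall t, t \in I -> phi t <= 1 -> phi t <= g t) ->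
  @sigma_porous R (nonexp_phi theta adm) g (~` @converging_iterates R X).
Proof.
move=> g_mono phi_g; have [eta Ieta star] := admissible_star adm.
have /andP[eta0 _] := admissible_itv adm Ieta.
have inI t : 0 < t <= eta -> t \in I.
  by move=> /(admissible_itvS adm); apply.
pose v := eta / 2; have v0 : 0 < v by rewrite divr_gt0.
have veta : v < eta by rewrite /v; lra.
have Iv : v \in I by apply: inI; rewrite v0 ltW.
have pv : 0 < phi v by exact: (adm_gt0 adm).
pose w (n : nat) := inv_on I phi n.+1%:R^-1 / 2.
apply: (@sigma_porous_nonconverging R X S hS theta (nonexp_phi theta adm)
  (fun f => f) (fun f => f) _ g w eta) => //.
- exact: dist_phi_damped.
- by move=> n; rewrite divr_gt0// inv_onP.
- exact: dist_phi_near_ball.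
- by move=> t u; rewrite !in_itv/= => ht hu; apply: g_mono; exact: inI.
(* As phi(t)/t is nonincreasing, its value at [v] is a lower bound for the slope at [c * t < v]. *)
- move=> c /andP[c0 c1]; exists (phi v / v * c).
    by rewrite mulr_gt0// divr_gt0.
  near=> t; have t0 : 0 < t by near: t; exact: nbhs_right_gt.
  have tv : t < v by near: t; exact: nbhs_right_lt.
  have ct0 : 0 < c * t by rewrite mulr_gt0.
  have ctt : c * t <= t by rewrite ler_piMl// ltW.
  have It : t \in I by apply: inI; lra.
  have Ict : c * t \in I by apply: inI; lra.
  apply: (@le_trans _ _ (phi (c * t))).
    have : 0 < c * t < v by rewrite ct0 (le_lt_trans ctt).
    move=> /star/(_ veta) h.
    by rewrite -mulrA mulrAC ler_pdivrMr// mulrC [leRHS]mulrC.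
  apply: phi_g => //; apply: le_trans (admissible_mono adm Ict It ctt) _.
  apply: le_trans (ler_norm _) _; rewrite -normrN -sub0r ltW//; near: t.
  by have /cvgrPdist_lt := adm_lim0 adm; apply.
(* With phi(u) = 1/n.+1, halving the argument at most halves the value, which absorbs the factor 1/2
   in [w]. *)
- exists 2^-1; first by rewrite invr_gt0.
  near=> n; have [Iu pu] := inv_onK adm n; rewrite /w.
  set u := inv_on I phi _ in Iu pu *.
  have u0 : 0 < u by exact: inv_onP.
  have uv : u < v.
    rewrite ltNge; apply/negP => /(admissible_mono adm Iv Iu).
    rewrite pu leNgt => /negP; apply; near: n.
    exact: (near_infty_natSinv_lt (PosNum pv)).
  have Iu2 : u / 2 \in I by apply: inI; lra.
  have u2u : u / 2 <= u by lra.
  apply: (@le_trans _ _ (phi (u / 2))).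
    have : 0 < u / 2 < u by lra.
    move=> /star/(_ (lt_trans uv veta)); rewrite -mulrA ler_pM2l//.
    by rewrite pu.
  apply: phi_g => //; apply: le_trans (admissible_mono adm Iu2 Iu u2u) _.
  by rewrite pu invf_le1 ?ler1n.
Unshelve. all: by end_near. Qed.

Lemma sigma_porous_s {s : R} (s1 : 1 <= s) :
  @sigma_porous R (nonexp_s theta s1) (fun t => t `^ s^-1)
    (~` @converging_iterates R X).
Proof.
have s0 : 0 < s by exact: lt_le_trans s1.
have sV0 : 0 <= s^-1 by rewrite invr_ge0 ltW.
pose w (n : nat) : R := (1 + n.+1%:R `^ s)^-1.
have w0 n : 0 < w n by rewrite invr_gt0 ltr_wpDr ?powR_ge0.
apply: (@sigma_porous_nonconverging R X S hS theta (nonexp_s theta s1)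
  (fun f => f) (fun f => f) _ _ w 1) => //.
- exact: (dist_s_damped theta s1).
- exact: (dist_s_near_ball s1).
- move=> t u; rewrite !in_itv/= => /andP[t0 _] /andP[u0 _] tu.
  by apply: ge0_ler_powR => //; rewrite nnegrE ltW.
- move=> c /andP[c0 c1]; exists (c `^ s^-1); first exact: powR_gt0.
  near=> t; have t0 : 0 < t by near: t; exact: nbhs_right_gt.
  have t1 : t <= 1 by near: t; exact: nbhs_right_le.
  rewrite powRM ?(ltW c0) ?(ltW t0)// ler_pM2l ?powR_gt0//.
  apply: ger1_powR; first by rewrite t0.
  by rewrite invf_le1.
(* Since n.+1^s >= 1, [w n] is at least half of n.+1^(-s), whose power 1/s is 1/n.+1. *)
- exists (2^-1 `^ s^-1); first by rewrite powR_gt0// invr_gt0.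
  near=> n.
  have n1 : 1 <= n.+1%:R `^ s :> R.
    by apply: le_trans (le1r_powR _ s1); rewrite ler1n.
  have -> : n.+1%:R^-1 = (n.+1%:R `^ s)^-1 `^ s^-1 :> R.
    by rewrite -powRN -powRrM mulNr divff ?lt0r_neq0// powR_inv1.
  have p0 : 0 < (n.+1%:R `^ s)^-1 :> R by rewrite invr_gt0; lra.
  rewrite -powRM ?(ltW p0) ?invr_ge0//.
  apply: ge0_ler_powR; rewrite // ?nnegrE ?(ltW (w0 n))//.
  by rewrite -invfM lef_pV2 ?posrE; lra.
Unshelve. all: by end_near. Qed.

End sigma_porous_metrics.

Theorem corollary3p8 (R : realType) (X : metricType R) (S : set (set X))
    (hS : hyperbolic S) (X_complete : complete_metric X)
    (X_unbounded : unbounded_metric X) (theta : X)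
    (I : interval R) (phi : R -> R) (adm : admissible I phi)
    (s : R) (s1 : 1 <= s) :
  [/\ @sigma_porous R (nonexp_phi theta adm) (fun t => Num.sqrt (phi t))
        (~` @converging_iterates R X),
      @sigma_porous R (nonexp_s theta s1) (fun t => t `^ s^-1)
        (~` @converging_iterates R X) &
      (forall a b t : R, 1 <= a -> 1 <= b -> 0 < t < 1 ->
         inv_on I phi (t / (a + b)) <=
         inv_on I phi (t / a) * inv_on I phi (t / b)) ->
      @sigma_porous R (nonexp_phi theta adm) phi
        (~` @converging_iterates R X)].
Proof.
split; last move=> _.
- apply: (sigma_porous_phi hS X_complete).
    by move=> t u It Iu tu; rewrite ler_wsqrtr// (admissible_mono adm).
  move=> t It pt1; have pt := ltW (adm_gt0 adm It).
  rewrite -{1}(sqr_sqrtr pt) expr2 ler_piMl ?sqrtr_ge0//.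
  by rewrite -sqrtr1 ler_wsqrtr.
- exact: (sigma_porous_s hS X_complete).
- by apply: (sigma_porous_phi hS X_complete) => //; exact: admissible_mono.
Qed.
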